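(* Let $k$ be an algebraically closed field of characteristic $2$, let $m\geq 1$ be an integer with $m+1=2n$, fix $\infty\in\mathbb{P}^1_k$ and a coordinate $z$ on $\mathbb{P}^1_k\setminus\{\infty\}$. Let $x_1,\dots,x_n\in k$ be pairwise distinct and let $u\neq v\in k^*$. Then there exist $f_1(z)=\prod_{i=1}^n(z-x_i)(z-y_i)$ and $f_2(z)=\prod_{i=1}^n(z-x_i)(z-z_i)$ with $x_1,\dots,x_n,y_1,\dots,y_n,z_1,\dots,z_n\in k$ pairwise distinct, such that $\omega_1:=\frac{\mathrm{d}f_1}{f_1}$ and $\omega_2:=\frac{\mathrm{d}f_2}{f_2}$ satisfy $$\omega_1=\frac{u\,\mathrm{d}z}{\prod_{i=1}^n(z-x_i)(z-y_i)},\qquad \omega_2=\frac{v\,\mathrm{d}z}{\prod_{i=1}^n(z-x_i)(z-z_i)}.$$ Thus $\mathbb{F}_2\omega_1+\mathbb{F}_2\omega_2$ is an $L_{m+1,2}$. Conversely, every $L_{m+1,2}$ is of this form.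
   Context: A differential form on $\mathbb{P}^1_k$ is called logarithmic if it is of the form $\frac{\mathrm{d}f}{f}$ with $f\in k(\mathbb{P}^1)^*$. For integers $m\geq1$, $n\geq 1$, an $L_{m+1,n}$ denotes an $\mathbb{F}_p$-vector space of dimension $n$ of logarithmic differential forms on $\mathbb{P}^1_k$ (here $p=2$) such that every nonzero element has exactly one zero, at the fixed point $\infty$, of order $m-1$. *)

(* Defs.v *)
From mathcomp Require Import all_boot all_order all_algebra.
From mathcomp Require Import ring zify.

Set Implicit Arguments.
Unset Strict Implicit.
Unset Printing Implicit Defensive.
Import GRing.Theory.
Local Open Scope ring_scope.
Local Open Scope quotient_scope.

(* The function field k(P^1) = k(z), the coordinate z being 'X : {poly k}. *)
Definition ratfun (k : fieldType) : fieldType := {fraction {poly k}}.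

(* The k(z)-module of rational differential forms on P^1 is free on dz; the
   form g dz is represented by its coefficient g. *)
Definition diffform (k : fieldType) : fieldType := ratfun k.

Definition of_poly (k : fieldType) (p : {poly k}) : ratfun k :=
  FracField.tofrac p.

(* d/dz by the quotient rule on the chosen representative of the fraction;
   [rderivE] shows that the representative does not matter. *)
Definition rderiv (k : fieldType) (f : ratfun k) : ratfun k :=
  let n := \n_(repr f) in let d := \d_(repr f) in
  of_poly (n^`() * d - n * d^`()) / of_poly (d ^+ 2).

(* df / f = (f' / f) dz *)
Definition dlog (k : fieldType) (f : ratfun k) : diffform k := rderiv f / f.

Definition logarithmic (k : fieldType) (w : diffform k) : Prop :=
  exists2 f : ratfun k, f != 0 & w = dlog f.

(* Order of vanishing of the form g dz at a point of P^1 = k \cup {oo}, where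
   None is oo. At a in k, dz generates the differentials; at oo, dz has a
   double pole, and g has order deg (denominator) - deg (numerator).
   Meaningful for g != 0 only, and independent of the representative
   ([ord_formE]). *)
Definition ord_form (k : fieldType) (P : option k) (g : diffform k) : int :=
  let n := \n_(repr g) in let d := \d_(repr g) in
  if P is Some a then (mup a n)%:Z - (mup a d)%:Z
  else (size d)%:Z - (size n)%:Z - 2.

(* For e = 0 this says that there is no zero and that oo is not a pole. *)
Definition only_zero_at_infty (k : fieldType) (e : nat) (w : diffform k) : Prop :=
  ord_form None w = e%:Z /\ forall a : k, ord_form (Some a) w <= 0.

(* diffform k has no 'F_p-module instance; in characteristic p, c : 'F_p acts
   on a form w as w *+ c. *)
Definition Fp_comb (k : fieldType) (p d : nat) (w : d.-tuple (diffform k))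
    (c : 'I_d -> 'F_p) : diffform k :=
  \sum_(i < d) tnth w i *+ c i.

Definition Fp_span (k : fieldType) (p d : nat) (w : d.-tuple (diffform k))
    (h : diffform k) : Prop :=
  exists c : 'I_d -> 'F_p, h = Fp_comb w c.

Definition Fp_free (k : fieldType) (p d : nat) (w : d.-tuple (diffform k)) : Prop :=
  forall c : 'I_d -> 'F_p, Fp_comb w c = 0 -> forall i, c i = 0.

(* [is_L p m d W]: W is an L_{m+1,d} in characteristic p. *)
Definition is_L (k : fieldType) (p m d : nat) (W : diffform k -> Prop) : Prop :=
  [/\ exists2 w : d.-tuple (diffform k), Fp_free p w & forall h, W h <-> Fp_span p w h,
      forall h, W h -> logarithmic h
    & forall h, W h -> h != 0 -> only_zero_at_infty m.-1 h].

Definition pairprod (k : fieldType) (n : nat) (x y : n.-tuple k) : {poly k} :=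
  \prod_(i < n) (('X - (tnth x i)%:P) * ('X - (tnth y i)%:P)).

Definition omega (k : fieldType) (n : nat) (x y : n.-tuple k) : diffform k :=
  dlog (of_poly (pairprod x y)).

Section Representatives.
Variable k : fieldType.
Implicit Types (p q : {poly k}) (f : ratfun k).

Lemma ratfun_repr f :
  f = of_poly \n_(repr f) / of_poly \d_(repr f) /\ \d_(repr f) != 0.
Proof.
have d0 := denom_ratioP (repr f); split=> //.
have dF : of_poly \d_(repr f) != 0 by rewrite tofrac_eq0.
apply: (mulIf dF); rewrite mulfVK //.
rewrite /of_poly -{1}(reprK f); unlock FracField.tofrac.
rewrite -[LHS]FracField.pi_mul; apply/eqmodP.
rewrite /= FracField.equivfE /FracField.mulf.
by rewrite !numden_Ratio ?mulr1 ?oner_neq0 // mulrC.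
Qed.

Lemma of_poly_div_eq p q p' q' : q != 0 -> q' != 0 ->
  of_poly p / of_poly q = of_poly p' / of_poly q' -> p * q' = p' * q.
Proof.
move=> q0 q'0 /eqP; rewrite /of_poly eqr_div ?tofrac_eq0 //.
by rewrite -!tofracM tofrac_eq => /eqP.
Qed.

Lemma rderivE p q : q != 0 ->
  rderiv (of_poly p / of_poly q)
    = of_poly (p^`() * q - p * q^`()) / of_poly (q ^+ 2).
Proof.
move=> q0; set f := of_poly p / of_poly q; rewrite /rderiv.
have [fE d0] := ratfun_repr f.
move: (\n_(repr f)) (\d_(repr f)) fE d0 => n d fE d0.
have E : p * d = n * q by apply: of_poly_div_eq.
have E' := congr1 (fun r => r^`()) E; rewrite /= !derivM in E'.
apply/eqP; rewrite /of_poly eqr_div ?tofrac_eq0 ?expf_neq0 //.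
rewrite -!tofracM tofrac_eq; apply/eqP.
have -> : (n^`() * d - n * d^`()) * q ^+ 2
    = (n^`() * q + n * q^`()) * d * q - (n * q) * (q^`() * d + d^`() * q) by ring.
by rewrite -E -E'; ring.
Qed.

Lemma ord_formE p q (P : option k) : p != 0 -> q != 0 ->
  ord_form P (of_poly p / of_poly q)
    = if P is Some a then (mup a p)%:Z - (mup a q)%:Z
      else (size q)%:Z - (size p)%:Z - 2.
Proof.
move=> p0 q0; set f := of_poly p / of_poly q; rewrite /ord_form.
have [fE d0] := ratfun_repr f.
move: (\n_(repr f)) (\d_(repr f)) fE d0 => n d fE d0.
have E : p * d = n * q by apply: of_poly_div_eq.
have n0 : n != 0.
  by apply: contraTneq (mulf_neq0 p0 d0) => n0; rewrite E n0 mul0r eqxx.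
case: P => [a|].
  by have := congr1 (mup a) E; rewrite !mupM //; lia.
have := congr1 (fun r : {poly k} => size r) E; rewrite /= !size_mul //.
move: p0 q0 n0 d0; rewrite -!size_poly_gt0.
by move: (size _) (size _) (size _) (size _) => a b c e; lia.
Qed.

End Representatives.

(* Main.v *)
(* In characteristic 2 the form df/f depends only on f modulo squares, so f may
   be taken to be a product F of distinct factors z - a. Then F and F' are
   coprime, hence df/f has no zero outside oo iff F' is a nonzero constant.
   Write X, Y, Z for the products over the x_i, y_i, z_i. Given X, interpolate
   h(x_i)^2 = x_i and let Q = (h^2 + z) / X: then (X Q)' = 1, and Y = X + u Q,
   Z = X + v Q satisfy X Y = X^2 + u X Q, (X Y)' = u and (X Z)' = v. The third
   nonzero form of the span is d(YZ)/(YZ), and X (Y Z)' = u Z + v Y has degree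
   deg X exactly when u != v, which makes (Y Z)' a nonzero constant. For the
   converse, X collects the common poles of two basis forms, Y and Z the other
   poles; the three forms have 2n poles each, so deg X = deg Y = deg Z = n. *)
Require Import Defs.
From mathcomp Require Import all_boot all_order all_algebra.
From mathcomp Require Import separable ring zify.
Set Implicit Arguments.
Unset Strict Implicit.
Unset Printing Implicit Defensive.
Import GRing.Theory.
Local Open Scope ring_scope.

(** * Products of linear factors and their logarithmic derivatives *)

Definition rootprod (k : fieldType) (s : seq k) : {poly k} :=
  \prod_(a <- s) ('X - a%:P).

Lemma logderiv_quotient (F : fieldType) (P Q P' Q' : F) : P != 0 -> Q != 0 ->
  (P' * Q - P * Q') / (Q * Q) / (P / Q) = P' / P - Q' / Q.
Proof. by move=> P0 Q0; field; rewrite P0 Q0. Qed.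

Section RootProducts.
Variable k : fieldType.
Implicit Types (p q : {poly k}) (s t : seq k) (a : k) (f : ratfun k).

Lemma rootprod_monic s : rootprod s \is monic.
Proof. exact: monic_prod_XsubC. Qed.

Lemma rootprod_neq0 s : rootprod s != 0.
Proof. exact/monic_neq0/rootprod_monic. Qed.

Lemma size_rootprod s : size (rootprod s) = (size s).+1.
Proof. exact: size_prod_XsubC. Qed.

Lemma coef_rootprod s i : i = size s -> (rootprod s)`_i = 1.
Proof.
move=> ->; have /monicP := rootprod_monic s.
by rewrite lead_coefE size_rootprod.
Qed.

Lemma rootprod_cat s t : rootprod (s ++ t) = rootprod s * rootprod t.
Proof. by rewrite /rootprod big_cat. Qed.

Lemma pairprodE (n : nat) (x y : n.-tuple k) : pairprod x y = rootprod (x ++ y).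
Proof. by rewrite /pairprod big_split rootprod_cat /rootprod !big_tuple. Qed.

Lemma of_poly_eq0 p : (of_poly p == 0) = (p == 0).
Proof. by rewrite /of_poly tofrac_eq0. Qed.

Lemma of_polyM : {morph @of_poly k : p q / p * q}.
Proof. exact: tofracM. Qed.

Lemma of_polyB : {morph @of_poly k : p q / p - q}.
Proof. exact: tofracB. Qed.

Lemma dlog_poly p : dlog (of_poly p) = of_poly p^`() / of_poly p.
Proof.
have := @rderivE k p 1 (oner_neq0 _).
rewrite /of_poly tofrac1 divr1 derivC mulr0 subr0 mulr1 expr1n tofrac1 divr1.
by rewrite /dlog => ->.
Qed.

Lemma dlogM p q : p != 0 -> q != 0 ->
  dlog (of_poly (p * q)) = dlog (of_poly p) + dlog (of_poly q).
Proof.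
move=> p0 q0; rewrite !dlog_poly derivM addf_div ?of_poly_eq0 //.
rewrite /of_poly !(tofracM, tofracD).
by rewrite (mulrC (FracField.tofrac p) (FracField.tofrac q^`())).
Qed.

Lemma dlog_div p q : p != 0 -> q != 0 ->
  dlog (of_poly p / of_poly q) = dlog (of_poly p) - dlog (of_poly q).
Proof.
move=> p0 q0; rewrite !dlog_poly /dlog rderivE //.
by rewrite expr2 of_polyB !of_polyM logderiv_quotient ?of_poly_eq0.
Qed.

Lemma dlogZ (c : k) p : c != 0 -> dlog (of_poly (c *: p)) = dlog (of_poly p).
Proof.
move=> c0; rewrite !dlog_poly derivZ -!mul_polyC /of_poly !tofracM.
by rewrite -mulf_div divff ?mul1r // tofrac_eq0 polyC_eq0.
Qed.

Lemma dlog1 : dlog (of_poly (1 : {poly k})) = 0.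
Proof. by rewrite dlog_poly derivC /of_poly tofrac0 mul0r. Qed.

Lemma dlog_rootprod_sum s :
  dlog (of_poly (rootprod s)) = \sum_(a <- s) dlog (of_poly ('X - a%:P)).
Proof.
elim: s => [|a s IH]; first by rewrite /rootprod !big_nil dlog1.
rewrite -cat1s rootprod_cat dlogM ?rootprod_neq0 // big_cons IH.
by rewrite /rootprod big_seq1.
Qed.

(** A nonzero constant derivative is coprime to the polynomial, which is therefore separable. *)
Lemma rootprod_uniq s (u : k) : u != 0 -> (rootprod s)^`() = u%:P -> uniq s.
Proof.
move=> u0 D; rewrite -separable_prod_XsubC unlock.
by rewrite -/(rootprod s) D -alg_polyC coprimepZr ?coprimep1.
Qed.

(** The form is [u] dz over the product: its numerator has no root, and its order at infinity is the
    number of poles minus 2. *)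
Lemma ord_rootprod s (u : k) : u != 0 -> (rootprod s)^`() = u%:P ->
  forall e, size s = e.+2 ->
  only_zero_at_infty e (dlog (of_poly (rootprod s))).
Proof.
move=> u0 D e se; have U0 : u%:P != 0 by rewrite polyC_eq0.
rewrite dlog_poly D; split=> [|a]; rewrite ord_formE ?rootprod_neq0 //.
  by rewrite size_rootprod size_polyC u0 se; lia.
have -> : mup a u%:P = 0%N by apply: mupNroot; rewrite rootC.
by lia.
Qed.

(** Both sides have the same denominator, so a condition on forms becomes one on the derivative of a
    polynomial. *)
Lemma omegaE (n : nat) (x y : n.-tuple k) (u : k) :
  omega x y = of_poly u%:P / of_poly (pairprod x y) <->
  (rootprod (x ++ y))^`() = u%:P.
Proof.
rewrite /omega pairprodE dlog_poly; split=> [|-> //].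
have P0 := rootprod_neq0 (x ++ y).
by move/(of_poly_div_eq P0 P0)/(mulIf P0).
Qed.

(** Newton interpolation: a multiple of [rootprod s] corrects the value at a new node and keeps the
    values at the old ones. *)
Lemma interpolation (r : k -> k) s : uniq s ->
  exists2 h : {poly k}, (size h <= size s)%N & forall a, a \in s -> h.[a] = r a.
Proof.
elim: s => [|a s IH] /=; first by exists 0; rewrite ?size_poly0.
case/andP=> aNs /IH [h hs hr].
have R0 : (rootprod s).[a] != 0 by rewrite -rootE root_prod_XsubC.
exists (h + ((r a - h.[a]) / (rootprod s).[a]) *: rootprod s).
  rewrite (leq_trans (size_polyD _ _)) // geq_max (leq_trans hs) //=.
  by rewrite (leq_trans (size_scale_leq _ _)) // size_rootprod.
move=> b; rewrite inE !hornerE => /predU1P[->|bs]; last first.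
  have /rootP -> : root (rootprod s) b by rewrite root_prod_XsubC.
  by rewrite mulr0 addr0 hr.
by rewrite mulfVK // addrC subrK.
Qed.

End RootProducts.

(** * Poles and zeros over an algebraically closed field *)

Section ClosedField.
Variable k : closedFieldType.
Implicit Types (p q : {poly k}) (s t : seq k) (a : k) (f : ratfun k).

Lemma monic_rootprod p : p \is monic -> exists s, p = rootprod s.
Proof.
move=> /monicP pm; have [s ps] := closed_field_poly_normal p.
by exists s; rewrite ps pm scale1r.
Qed.

(** Equal terms cancel in pairs, so [t] keeps the points that occur an odd number of times in [s].
    This discards the square factors of f in df/f. *)
Lemma sum_odd_multiplicity (V : zmodType) (F : k -> V) s :
  (forall x : V, x + x = 0) ->
  exists2 t, uniq t & \sum_(a <- s) F a = \sum_(a <- t) F a.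
Proof.
move=> V2; elim: s => [|a s [t tu E]]; first by exists [::].
rewrite big_cons E; have [at_|aNt] := boolP (a \in t).
  exists (rem a t); first exact: rem_uniq.
  by rewrite (perm_big _ (perm_to_rem at_)) big_cons /= addrA V2 add0r.
by exists (a :: t); rewrite ?big_cons //= aNt.
Qed.

(** By separability a root of the derivative is not a pole, so it would be a finite zero of the
    form. Hence the derivative is constant, and the order at infinity counts the poles. *)
Lemma only_zero_rootprod s e : uniq s ->
  dlog (of_poly (rootprod s)) != 0 ->
  only_zero_at_infty e (dlog (of_poly (rootprod s))) ->
  size s = e.+2 /\ exists2 u : k, u != 0 & (rootprod s)^`() = u%:P.
Proof.
move=> su; rewrite dlog_poly => w0 [].
have D0 : (rootprod s)^`() != 0.
  by apply: contraNneq w0 => ->; rewrite /of_poly tofrac0 mul0r.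
rewrite ord_formE ?rootprod_neq0 // => ordoo orda.
have [size1|/closed_rootP [a ra]] := eqVneq (size (rootprod s)^`()) 1%N; last first.
  have := orda a; rewrite ord_formE ?rootprod_neq0 //.
  have cop : coprimep (rootprod s) (rootprod s)^`().
    by move: su; rewrite -separable_prod_XsubC unlock.
  have Nra : ~~ root (rootprod s) a.
    by apply: contraL ra => ra; apply: (coprimep_root cop ra).
  rewrite (mupNroot Nra) subr0; have := XsubC_dvd a D0.
  by rewrite dvdp_XsubCl ra; lia.
have [u u0 E] := size_poly1P _ (introT eqP size1); split; last by exists u; rewrite ?E.
(* The two occurrences of [size s] are convertible but not identical, which
   lia does not see. *)
move: ordoo; rewrite size1 size_rootprod; move: (size s) => N; lia.
Qed.

Lemma exists_sqrt : exists r : k -> k, forall a, r a ^+ 2 = a.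
Proof.
have P a : exists b, b ^+ 2 == a.
  (* The coefficients encode the equation b^2 = a + 0 b. *)
  have [b Hb] := @solve_monicpoly k 2 (fun i => if i == 0%N then a else 0) isT.
  by exists b; rewrite Hb !big_ord_recl big_ord0 /= expr0 mulr1 mul0r !addr0.
by exists (fun a => xchoose (P a)) => a; apply/eqP/(xchooseP (P a)).
Qed.

Lemma seq_common_part s1 s2 : uniq s1 -> uniq s2 ->
  exists s t t' : seq k,
    [/\ uniq (s ++ t ++ t'), perm_eq s1 (s ++ t) & perm_eq s2 (s ++ t')].
Proof.
move=> u1 u2; exists [seq a <- s1 | a \in s2],
  [seq a <- s1 | a \notin s2], [seq a <- s2 | a \notin s1].
split.
- rewrite !cat_uniq !filter_uniq //= has_cat negb_or andbT -!all_predC.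
  apply/andP; split; [apply/andP; split|]; apply/allP => a /=; rewrite !mem_filter.
  + by case/andP=> /negPf->.
  + by case/andP=> /negPf-> ->; rewrite andbF.
  + by case/andP=> /negPf-> ->.
- by rewrite perm_sym; apply/permPl/perm_filterC.
- apply: uniq_perm => //.
    rewrite cat_uniq !filter_uniq //= andbT; apply/hasPn => a /=.
    by rewrite !mem_filter => /andP[/negPf-> ->].
  by move=> a; rewrite mem_cat !mem_filter; case: (a \in s1); case: (a \in s2).
Qed.

(** * Logarithmic forms in characteristic 2 *)

Hypothesis k2 : 2%N \in [pchar k].

Lemma poly_pchar2 : 2%N \in [pchar {poly k}].
Proof. exact: (rmorph_pchar (@polyC k)). Qed.

Lemma ratfun_pchar2 : 2%N \in [pchar (ratfun k)].
Proof. exact: (rmorph_pchar (@FracField.tofrac {poly k}) poly_pchar2). Qed.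

Lemma deriv_sqr p : (p ^+ 2)^`() = 0.
Proof. by rewrite expr2 derivM [p * _]mulrC (addrr_pchar2 poly_pchar2). Qed.

Lemma logarithmic_rootprod w : logarithmic w ->
  exists2 s : seq k, uniq s & w = dlog (of_poly (rootprod s)).
Proof.
case=> f f0 ->; have [fE d0] := ratfun_repr f.
move: (\n_(repr f)) (\d_(repr f)) fE d0 => n d fE d0.
have n0 : n != 0.
  by apply: contraNneq f0 => n0; rewrite fE n0 /of_poly tofrac0 mul0r.
(* Signs do not matter, so n/d and n d, which differ by the square d^2, have the same logarithmic
   derivative. *)
rewrite fE dlog_div // (oppr_pchar2 ratfun_pchar2) -dlogM //.
have [s ->] := closed_field_poly_normal (n * d).
rewrite dlogZ ?lead_coef_eq0 ?mulf_neq0 // -/(rootprod s) dlog_rootprod_sum.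
have [t tu ->] := sum_odd_multiplicity
  (fun a => dlog (of_poly ('X - a%:P))) s (addrr_pchar2 ratfun_pchar2).
by exists t; rewrite ?dlog_rootprod_sum.
Qed.

(** In the expansion of (pq)' r + (pr)' q the term p' q r occurs twice and cancels. *)
Lemma deriv_cofactors p q r (u v : k) :
  (p * q)^`() = u%:P -> (p * r)^`() = v%:P ->
  p * (q * r)^`() = u *: r + v *: q.
Proof.
move=> Eu Ev; rewrite -!mul_polyC -Eu -Ev !derivM.
have H := addrr_pchar2 poly_pchar2 (p^`() * q * r).
have -> : (p^`() * q + p * q^`()) * r + (p^`() * r + p * r^`()) * q =
  (p^`() * q * r + p^`() * q * r) + p * (q^`() * r + q * r^`()) by ring.
by rewrite H add0r.
Qed.

Lemma sum_dlog_cofactors s t t' :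
  dlog (of_poly (rootprod (s ++ t))) + dlog (of_poly (rootprod (s ++ t'))) =
  dlog (of_poly (rootprod (t ++ t'))).
Proof.
rewrite !rootprod_cat !dlogM ?rootprod_neq0 // addrACA.
by rewrite (addrr_pchar2 ratfun_pchar2) add0r.
Qed.

(** * Construction of Y and Z from X, and comparison of the derivatives *)

Lemma exists_cofactor s : (0 < size s)%N -> uniq s ->
  exists2 q : {poly k}, (size q <= size s)%N & (rootprod s * q)^`() = 1.
Proof.
move=> s0 su; have [r rE] := exists_sqrt; have [h hs hr] := interpolation r su.
have : rootprod s %| h ^+ 2 + 'X.
  apply: uniq_roots_dvdp; last by rewrite uniq_rootsE.
  apply/allP => a /hr ha.
  by rewrite rootE !hornerE ha rE (addrr_pchar2 k2).
case/dvdpP=> q E; have Ed : (rootprod s * q)^`() = 1.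
  by rewrite mulrC -E derivD deriv_sqr derivX add0r.
exists q => //; have q0 : q != 0.
  by apply: contra_eq_neq Ed => ->; rewrite mulr0 derivC eq_sym oner_neq0.
(* With N points, h^2 has degree at most 2N - 2, and 'X has degree 1, at most 2N - 1 because N is
   positive. Dividing by [rootprod s] leaves degree below N. *)
have : (size (h ^+ 2 + 'X)%R <= (size s).*2)%N.
  rewrite (leq_trans (size_polyD _ _)) // geq_max size_polyX.
  apply/andP; split; last by lia.
  rewrite expr2 (leq_trans (size_polyMleq _ _)) //.
  by move: hs; move: (size h) (size s) => N M; lia.
rewrite E size_mul ?rootprod_neq0 // size_rootprod.
by move: (size s) (size q) => N M; lia.
Qed.

(** As q has smaller degree than X, X + u q is monic of the degree of X and splits. In X (X + u q)
    the square X^2 has derivative zero. *)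
Lemma rootprod_cofactor s q (u : k) : (size q <= size s)%N ->
  (rootprod s * q)^`() = 1 ->
  exists t : seq k, [/\ size t = size s, rootprod t = rootprod s + u *: q
    & (rootprod (s ++ t))^`() = u%:P].
Proof.
move=> qs qD; have lt_size : (size (u *: q)%R < size (rootprod s))%N.
  by rewrite size_rootprod ltnS (leq_trans (size_scale_leq _ _)).
have [t tE] : exists t, rootprod s + u *: q = rootprod t.
  apply: monic_rootprod; rewrite monicE lead_coefDl //.
  by rewrite -monicE rootprod_monic.
exists t; split=> //.
  by apply: succn_inj; rewrite -!size_rootprod -tE size_polyDl.
rewrite rootprod_cat -tE mulrDr -expr2 derivD deriv_sqr add0r.
by rewrite -scalerAr derivZ qD alg_polyC.
Qed.

(** A common root of X + u q and X + v q is a root of (u - v) q, hence of q and then of X, which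
    contradicts the disjointness of [s] and [t]. *)
Lemma uniq_cofactors s t t' q (u v : k) : u != v ->
  rootprod t = rootprod s + u *: q -> rootprod t' = rootprod s + v *: q ->
  uniq (s ++ t) -> uniq (s ++ t') -> uniq (s ++ t ++ t').
Proof.
move=> uv tE t'E; rewrite !cat_uniq has_cat.
rewrite negb_or => /and3P[-> st ->] /and3P[_ -> ->]; rewrite st !andbT /=.
apply/hasPn => a at'; apply/negP => at_.
have : (rootprod t).[a] = 0 by apply/rootP; rewrite root_prod_XsubC.
have : (rootprod t').[a] = 0 by apply/rootP; rewrite root_prod_XsubC.
rewrite tE t'E !hornerE => Ev Eu.
have q0 : q.[a] = 0.
  have : (u - v) * q.[a] = 0.
    by rewrite -[RHS](subrr 0) -{1}Eu -Ev; ring.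
  by move/eqP; rewrite mulf_eq0 subr_eq0 (negPf uv) => /eqP.
move: Eu; rewrite q0 mulr0 addr0 => /eqP.
by rewrite -rootE root_prod_XsubC; apply/negP; move/hasPn: st; apply.
Qed.

Lemma cofactors_deriv s t t' (u v : k) : u != v ->
  size s = size t -> size s = size t' ->
  (rootprod (s ++ t))^`() = u%:P -> (rootprod (s ++ t'))^`() = v%:P ->
  exists2 c : k, c != 0 & (rootprod (t ++ t'))^`() = c%:P.
Proof.
move=> uv st st'; rewrite !rootprod_cat => Du Dv.
have E := deriv_cofactors Du Dv; set D := (_ * _)^`() in E *.
have D0 : D != 0.
  (* If D vanished, so would the top coefficient u + v of u Z + v Y, forcing u = v. *)
  apply: contra_neq uv => D0; move: E.
  rewrite D0 mulr0 => /(congr1 (fun p => p`_(size s))).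
  rewrite coef0 coefD !coefZ !coef_rootprod // !mulr1 => /esym/eqP.
  by rewrite addr_eq0 (oppr_pchar2 k2) => /eqP.
(* X D = u Z + v Y has degree at most deg X, so D is constant. *)
have sD : size D == 1%N.
  have : (size (rootprod s * D)%R <= (size s).+1)%N.
    rewrite E (leq_trans (size_polyD _ _)) // geq_max.
    by rewrite !(leq_trans (size_scale_leq _ _)) // size_rootprod -?st -?st'.
  rewrite size_mul ?rootprod_neq0 // size_rootprod.
  by move: D0; rewrite -size_poly_gt0; move: (size s) (size D) => N M; lia.
by have [c c0 ->] := size_poly1P _ sD; exists c.
Qed.

(** Comparing top coefficients in c X = u Z + v Y gives c = u + v, which is zero when u = v. *)
Lemma cofactors_neq s t t' (u v c : k) : c != 0 ->
  size s = size t -> size s = size t' ->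
  (rootprod (s ++ t))^`() = u%:P -> (rootprod (s ++ t'))^`() = v%:P ->
  (rootprod (t ++ t'))^`() = c%:P -> u != v.
Proof.
move=> c0 st st'; rewrite !rootprod_cat => Du Dv Dc.
have := deriv_cofactors Du Dv; rewrite Dc => /(congr1 (fun p => p`_(size s))).
rewrite coefMC coefD !coefZ !coef_rootprod // mul1r !mulr1 => cE.
by apply: contraNneq c0 => uv; rewrite cE uv (addrr_pchar2 k2).
Qed.

End ClosedField.

(** * Spans and freeness of two forms over the field with two elements *)

Lemma F2_cases (c : 'F_2) : (c == 0) || (c == 1).
Proof. by case: c => [[|[|]]]. Qed.

Lemma Fp_comb2 (k : fieldType) (w : 2.-tuple (diffform k)) (c : 'I_2 -> 'F_2) :
  Fp_comb w c = tnth w 0 *+ c 0 + tnth w 1 *+ c 1.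
Proof.
rewrite /Fp_comb big_ord_recl big_ord1.
by congr (_ + tnth w _ *+ c _); apply: val_inj.
Qed.

Lemma Fp_span2 (k : fieldType) (w : 2.-tuple (diffform k)) h :
  Fp_span 2 w h <->
  [\/ h = 0, h = tnth w 0, h = tnth w 1 | h = tnth w 0 + tnth w 1].
Proof.
split=> [[c ->]|].
  rewrite Fp_comb2; have /orP[/eqP->|/eqP->] := F2_cases (c 0);
  have /orP[/eqP->|/eqP->] := F2_cases (c 1).
  - by apply: Or41; rewrite !mulr0n addr0.
  - by apply: Or43; rewrite !mulr0n add0r.
  - by apply: Or42; rewrite !mulr0n addr0.
  - by apply: Or44.
case=> ->; [exists (fun=> 0) | exists (fun i => if i == 0 then 1 else 0)
  | exists (fun i => if i == 0 then 0 else 1) | exists (fun=> 1)];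
  by rewrite Fp_comb2 /= ?mulr0n ?addr0 ?add0r.
Qed.

(** The nonzero coefficient vectors are (1,0), (0,1) and (1,1). *)
Lemma Fp_free2 (k : fieldType) (w : 2.-tuple (diffform k)) :
  Fp_free 2 w <->
  [/\ tnth w 0 != 0, tnth w 1 != 0 & tnth w 0 + tnth w 1 != 0].
Proof.
split=> [free | [n0 n1 n01] c].
  split; apply/eqP => E.
  - have := free (fun i => if i == 0 then 1 else 0).
    by rewrite Fp_comb2 /= E mulr0n addr0 => /(_ erefl 0).
  - have := free (fun i => if i == 0 then 0 else 1).
    by rewrite Fp_comb2 /= E mulr0n addr0 => /(_ erefl 1).
  - by have := free (fun=> 1); rewrite Fp_comb2 /= E => /(_ erefl 1).
rewrite Fp_comb2 => /eqP E i.
have [c0 c1] : c 0 = 0 /\ c 1 = 0.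
  have /orP[/eqP c0|/eqP c0] := F2_cases (c 0);
  have /orP[/eqP c1|/eqP c1] := F2_cases (c 1) => //;
  move: E; rewrite c0 c1 ?mulr0n ?addr0 ?add0r mulr1n => E; exfalso.
  - by rewrite E in n1.
  - by rewrite E in n0.
  - by rewrite E in n01.
case: i => [[|[|//]] li]; [rewrite -[RHS]c0|rewrite -[RHS]c1];
  by congr c; apply: val_inj.
Qed.

(** * Existence of the pair, the space it spans, and the converse *)

Theorem theorem2p8 (k : closedFieldType) (k_char2 : 2%N \in [pchar k])
    (m n : nat) (m_ge1 : (1 <= m)%N) (m_n : (m + 1 = 2 * n)%N) :
  [/\ (forall (x : n.-tuple k) (u v : k),
         uniq x -> u != 0 -> v != 0 -> u != v ->
         exists y z : n.-tuple k,
           [/\ uniq (x ++ y ++ z), omega x y = of_poly u%:P / of_poly (pairprod x y) & omega x z = of_poly v%:P / of_poly (pairprod x z)]),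
      (forall (x y z : n.-tuple k) (u v : k),
         u != 0 -> v != 0 -> u != v ->
         uniq (x ++ y ++ z) -> omega x y = of_poly u%:P / of_poly (pairprod x y) -> omega x z = of_poly v%:P / of_poly (pairprod x z) ->
         is_L 2 m 2 (Fp_span 2 [tuple omega x y; omega x z]))
    & (forall W : diffform k -> Prop, is_L 2 m 2 W ->
         exists (x y z : n.-tuple k) (u v : k),
           [/\ u != 0, v != 0 & u != v] /\
           [/\ uniq (x ++ y ++ z), omega x y = of_poly u%:P / of_poly (pairprod x y), omega x z = of_poly v%:P / of_poly (pairprod x z)
             & forall h, W h <-> Fp_span 2 [tuple omega x y; omega x z] h])].
Proof.
(* Since m is positive, [m.-1.+2] is m + 1 = 2n, the number of poles that goes with a zero of order
   [m.-1] at infinity. *)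
have sz (x y : n.-tuple k) : size (x ++ y) = m.-1.+2 by rewrite size_cat !size_tuple; lia.
have half a b c : (a + b = m.-1.+2 -> a + c = m.-1.+2 -> b + c = m.-1.+2 ->
  [/\ a = n, b = n & c = n])%N by move=> ab ac bc; split; lia.
split.
- move=> x u v xu u0 v0 uv.
  have x0 : (0 < size x)%N by rewrite size_tuple; lia.
  have [q qs qD] := exists_cofactor k_char2 x0 xu.
  have [y [ys yE yD]] := rootprod_cofactor k_char2 u qs qD.
  have [z [zs zE zD]] := rootprod_cofactor k_char2 v qs qD.
  have ys' : size y == n by rewrite ys size_tuple.
  have zs' : size z == n by rewrite zs size_tuple.
  exists (Tuple ys'), (Tuple zs'); split; [|exact/omegaE|exact/omegaE].
  apply: (uniq_cofactors uv yE zE) => //.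
    exact: (rootprod_uniq u0).
  exact: (rootprod_uniq v0).
- move=> x y z u v u0 v0 uv xyz /omegaE Du /omegaE Dv.
  have [c c0 Dc] := cofactors_deriv k_char2 uv
    (etrans (size_tuple x) (esym (size_tuple y)))
    (etrans (size_tuple x) (esym (size_tuple z))) Du Dv.
  have nz s (d : k) : d != 0 -> (rootprod s)^`() = d%:P ->
      dlog (of_poly (rootprod s)) != 0.
    move=> d0 Dd; rewrite dlog_poly Dd mulf_neq0 ?invr_eq0 ?of_poly_eq0 //.
      by rewrite polyC_eq0.
    exact: rootprod_neq0.
  have sumE : omega x y + omega x z = dlog (of_poly (rootprod (y ++ z))).
    by rewrite /omega !pairprodE sum_dlog_cofactors.
  have nz_xy : omega x y != 0 by rewrite /omega pairprodE (nz _ u).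
  have nz_xz : omega x z != 0 by rewrite /omega pairprodE (nz _ v).
  have spanE h : Fp_span 2 [tuple omega x y; omega x z] h ->
    [\/ h = 0, h = omega x y, h = omega x z | h = omega x y + omega x z].
    by move/Fp_span2.
  split.
  + exists [tuple omega x y; omega x z] => //; apply/Fp_free2.
    split; [exact: nz_xy|exact: nz_xz|].
    by rewrite -[X in X != 0]/(omega x y + omega x z) sumE (nz _ c).
  + have lg (s : seq k) : logarithmic (dlog (of_poly (rootprod s))).
      exists (of_poly (rootprod s)); last by [].
      by rewrite of_poly_eq0; exact: rootprod_neq0.
    move=> h /spanE [] ->.
    (* The zero form is the logarithmic derivative of 1, the empty product. *)
    * by have := lg [::]; rewrite /rootprod big_nil dlog1.
    * by rewrite /omega pairprodE.
    * by rewrite /omega pairprodE.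
    * by rewrite sumE.
  + move=> h /spanE [] -> h0.
    * by rewrite eqxx in h0.
    * by rewrite /omega pairprodE; apply: (ord_rootprod u0).
    * by rewrite /omega pairprodE; apply: (ord_rootprod v0).
    * by rewrite sumE; apply: (ord_rootprod c0).
- move=> W [[w free WE] Wlog Word].
  have /Fp_free2[n0 n1 n01] := free.
  have [W0 W1 W01] : [/\ W (tnth w 0), W (tnth w 1) & W (tnth w 0 + tnth w 1)].
    by split; apply/WE/Fp_span2; [apply: Or42|apply: Or43|apply: Or44].
  have [s1 u1 E1] := logarithmic_rootprod k_char2 (Wlog _ W0).
  have [s2 u2 E2] := logarithmic_rootprod k_char2 (Wlog _ W1).
  (* [x] lists the common poles of the two basis forms, [y] and [z] the poles of only one; the sum
     of the forms has its poles at [y ++ z]. *)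
  have [x [y [z [xyz p1 p2]]]] := seq_common_part u1 u2.
  have {}E1 : tnth w 0 = dlog (of_poly (rootprod (x ++ y))).
    by rewrite E1 /rootprod (perm_big _ p1).
  have {}E2 : tnth w 1 = dlog (of_poly (rootprod (x ++ z))).
    by rewrite E2 /rootprod (perm_big _ p2).
  have E12 : tnth w 0 + tnth w 1 = dlog (of_poly (rootprod (y ++ z))).
    by rewrite E1 E2 sum_dlog_cofactors.
  have uxy : uniq (x ++ y) by rewrite -(perm_uniq p1).
  have uxz : uniq (x ++ z) by rewrite -(perm_uniq p2).
  have uyz : uniq (y ++ z) by move: xyz; rewrite cat_uniq => /and3P[].
  have := Word _ W0 n0; move: n0; rewrite E1 => n0.
  move/(only_zero_rootprod uxy n0) => [s_xy [u u0 Du]].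
  have := Word _ W1 n1; move: n1; rewrite E2 => n1.
  move/(only_zero_rootprod uxz n1) => [s_xz [v v0 Dv]].
  have := Word _ W01 n01; move: n01; rewrite E12 => n01.
  move/(only_zero_rootprod uyz n01) => [s_yz [c c0 Dc]].
  move: s_xy s_xz s_yz; rewrite !size_cat => s_xy s_xz s_yz.
  have [/eqP sx /eqP sy /eqP sz'] := half _ _ _ s_xy s_xz s_yz.
  exists (Tuple sx), (Tuple sy), (Tuple sz'), u, v; split.
    split=> //; apply: (cofactors_neq k_char2 c0 _ _ Du Dv Dc).
      by rewrite (eqP sx) (eqP sy).
    by rewrite (eqP sx) (eqP sz').
  split=> //; [exact/omegaE|exact/omegaE|].
  (* The two forms are the given basis itself, so the spans coincide. *)
  suff -> : [tuple omega (Tuple sx) (Tuple sy); omega (Tuple sx) (Tuple sz')] = w by [].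
  apply: eq_from_tnth => i; case: (unliftP 0 i) => [j|] ->.
    rewrite (ord1 j) (tnth_nth 0) /= /omega pairprodE /= -E2.
    by congr (tnth w _); apply: val_inj.
  by rewrite (tnth_nth 0) /= /omega pairprodE /= -E1.
Qed.
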